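(* Let $M=[v_1|\cdots|v_n]$ be a nonnegative $2\times n$ real matrix with $\operatorname{rank}(M)=2$. Then $\operatorname{cvar}(M)=2$ if and only if $M$ can be constructed from the $2\times 2$ identity matrix $I_2$.
   Context: Cyclic sign variation: for $v\in\mathbb{R}^n$, $\operatorname{var}(v)$ is the number of sign changes between consecutive entries after deleting zeros; for nonzero $v$ with first nonzero entry $v_k$, $\operatorname{cvar}(v)=\operatorname{var}(v_k,\dots,v_n,v_k)$, and $\operatorname{cvar}(0)=0$. For a $2\times n$ matrix $M=[v_1|\cdots|v_n]$, $\Delta_i=\det[v_i|v_{i+1}]$ (indices mod $n$) and $\operatorname{cvar}(M)=\operatorname{cvar}(\Delta_1,\dots,\Delta_n)$. Column operations on a matrix $[v_1|\cdots|v_n]$: Join: replace adjacent columns $v_i,v_{i+1}$ by $v_i+v_{i+1}$; Double: replace $v_i$ by two adjacent copies $v_i|v_i$; Cyclic shift: $[v_1|\cdots|v_n]\mapsto[v_n|v_1|\cdots|v_{n-1}]$; Re-scale: replace $v_i$ by $a v_i$, $a\ge0$. $M$ can be constructed from $M'$ if $M$ is obtained from $M'$ by a finite sequence of these operations.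
   Formalization: The formal theorem additionally assumes every column v_i of M is nonzero; without this the claim is false, e.g. [e_1|0|e_2] is constructed from I_2 by Double and Re-scale with a=0, yet has cvar 0. *)

(* Defs.v *)
From mathcomp Require Import all_boot all_order all_algebra.
From mathcomp Require Import reals.
From Stdlib Require Import Relation_Operators.
Set Implicit Arguments.
Unset Strict Implicit.
Unset Printing Implicit Defensive.
Import Order.TTheory GRing.Theory Num.Theory.
Local Open Scope ring_scope.

Section SignVariation.
Variable R : realDomainType.

Definition var (v : seq R) : nat :=
  if [seq x <- v | x != 0] is x :: w
  then count id (pairmap (fun y z => Num.sg y != Num.sg z) x w)
  else 0%N.

(* [drop (find _ v) v] is the suffix v_k, ..., v_n starting at the first
   nonzero entry; it is empty exactly when v = 0. *)
Definition cvar (v : seq R) : nat :=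
  if drop (find (fun x => x != 0) v) v is x :: w
  then var (rcons (x :: w) x)
  else 0%N.

Variable n : nat.

(* [ordS] is the cyclic successor on 'I_n. *)
Definition Delta (M : 'M[R]_(2, n)) (i : 'I_n) : R :=
  \det (row_mx (col i M) (col (ordS i) M) : 'M[R]_2).

(* A zero column v_i kills both Delta_(i-1) and Delta_i, so this count says
   nothing about how the neighbours of v_i compare: [e1|0|e2] has value 0 although
   it arises from I_2 by Double and Rescale (a = 0). This is why the theorem
   assumes that the columns of M are nonzero. *)
Definition cvar_mx (M : 'M[R]_(2, n)) : nat :=
  cvar [seq Delta M i | i <- enum 'I_n].

End SignVariation.

Section Construction.
Variable R : realDomainType.

(* The operations change the number of columns, so they act on the sequence of
   columns v_1, ..., v_n. *)
Definition columns (n : nat) (M : 'M[R]_(2, n)) : seq 'cV[R]_2 :=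
  [seq col j M | j <- enum 'I_n].

Inductive column_op : seq 'cV[R]_2 -> seq 'cV[R]_2 -> Prop :=
| Join s1 u v s2 : column_op (s1 ++ u :: v :: s2) (s1 ++ (u + v) :: s2)
| Double s1 u s2 : column_op (s1 ++ u :: s2) (s1 ++ u :: u :: s2)
| CyclicShift s u : column_op (rcons s u) (u :: s)
| Rescale s1 u s2 (a : R) :
    0 <= a -> column_op (s1 ++ u :: s2) (s1 ++ (a *: u) :: s2).

Definition constructible_from (m n : nat)
    (M' : 'M[R]_(2, m)) (M : 'M[R]_(2, n)) : Prop :=
  clos_refl_trans _ column_op (columns M') (columns M).

End Construction.

(* Main.v *)
(* A nonnegative matrix has cvar at most 2 exactly when the directions of its
   columns, read cyclically, turn once counterclockwise and once clockwise: the
   sequence of columns splits as A ++ B ++ C with B turning one way and C ++ A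
   the other way.  Every column operation preserves such a splitting; for Join
   at a turning point, the sum lies between its two summands and so extends one
   of the two monotone parts.  Conversely any vector in the cone of two
   neighbours u, v can be inserted between them (double both, rescale the inner
   copies, join them).  Inserting successively next to e1 and next to e2
   produces e1, B, e2, C, A for every such splitting, and e1, e2 are then
   removed by rescaling them to 0 and joining.  Finally, rank 2 forces cvar > 0,
   since columns turning always the same way around the cycle are parallel. *)

Require Import Defs.
From mathcomp Require Import all_boot all_order all_algebra.
From mathcomp Require Import reals.
From mathcomp Require Import ring lra zify.
From Stdlib Require Import Relation_Operators.
Set Implicit Arguments.
Unset Strict Implicit.
Unset Printing Implicit Defensive.
Import Order.TTheory GRing.Theory Num.Theory.
Local Open Scope ring_scope.

(** * Counting sign changes of a sequence, linearly and cyclically *)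

Section SignChanges.
Variable R : realDomainType.
Implicit Types (x : R) (d l : seq R) (e : bool).

Definition wsign e x := if e then x <= 0 else 0 <= x.

Lemma wsign_total e x : wsign e x || wsign (~~ e) x.
Proof. by case: e; rewrite /= le_total. Qed.

Lemma wsign_both e x : wsign e x -> wsign (~~ e) x -> x = 0.
Proof. by case: e => /= h1 h2; apply/eqP; rewrite eq_le h1 h2. Qed.

Lemma wsignD e x y : wsign e x -> wsign e y -> wsign e (x + y).
Proof. by case: e => /= hx hy; [apply: ler_wnDl|apply: addr_ge0]. Qed.

Lemma wsignMl e a x : 0 <= a -> wsign e x -> wsign e (a * x).
Proof. by case: e => /= ha hx; [rewrite mulr_ge0_le0|rewrite mulr_ge0]. Qed.

Lemma wsign_pMl e a x : 0 < a -> wsign e (a * x) = wsign e x.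
Proof. by case: e => ha /=; [rewrite pmulr_rle0|rewrite pmulr_rge0]. Qed.

(* The number of sign changes of [d] when it is preceded by an entry of
   sign [(-1)^e]. *)
Fixpoint changes e d : nat :=
  if d is x :: d' then
    if x == 0 then changes e d'
    else if (x < 0) == e then changes e d' else (changes (~~ e) d').+1
  else 0.

Lemma changes_cat_wsign e d l :
  all (wsign e) d -> changes e (d ++ l) = changes e l.
Proof.
elim: d => //= x d IH /andP[hx /IH ->].
by case: e hx {IH} => /=; case: ltgtP.
Qed.

Lemma changes_flip e d : (changes e d <= (changes (~~ e) d).+1)%N.
Proof.
elim: d e => //= x d IH e; case: ifP => _ //.
by case: (x < 0); case: e => //=; [have := IH false|have := IH true]; lia.
Qed.

Lemma changes_cons e x d : (changes e (x :: d) <= (changes (~~ e) d).+1)%N.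
Proof.
rewrite /=; case: ifP => _; first exact: changes_flip.
by case: ifP => _ //; exact: changes_flip.
Qed.

Lemma changes0 e d : changes e d = 0%N -> all (wsign e) d.
Proof.
elim: d => //= x d IH.
case: ltgtP => //=; case: e IH => //= IH hx /IH -> //; rewrite ?hx ?lexx ?andbT //.
all: exact: ltW.
Qed.

(** The cut comes just before the first entry strictly of the opposite sign, if any; counting the
    rest from that sign saves the change paid there. *)
Lemma changes_split e d k : (changes e d <= k.+1)%N ->
  exists d1 d2, [/\ d = d1 ++ d2, all (wsign e) d1 & (changes (~~ e) d2 <= k)%N].
Proof.
elim: d => [_|x d IH]; first by exists [::], [::].
have [hx|hx] := boolP (wsign e x).
  move=> h; case: IH => [|d1 [d2 [-> h1 h2]]].
    by rewrite -[x :: d]/([:: x] ++ d) changes_cat_wsign //= ?hx in h.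
  by exists (x :: d1), d2; rewrite /= hx.
move=> h; exists [::], (x :: d); split => //.
by case: e hx h {IH} => /=; rewrite -ltNge => /[dup] hx /ltW hx'; case: ltgtP hx.
Qed.

(** The appended [x] has the starting sign, and signs around a closed cycle change an even number of
    times. *)
Lemma changes_rcons e d x : x != 0 -> e = (x < 0) ->
  changes e (rcons d x) = (changes e d + odd (changes e d))%N.
Proof.
move=> x0 ex.
(* The induction needs an arbitrary starting sign [f]: the sign reached at the end of [d] is [f]
   flipped [changes f d] times. *)
have -> f : changes f (rcons d x) =
   (changes f d + ((f (+) e) (+) odd (changes f d)))%N.
  elim: d f => [|y d IH] f /=.
    by rewrite (negPf x0) -ex; case: e f {ex} => [] [].
  case: ifP => // _; case: ifP => // _; rewrite IH addSn.
  by congr (_ + _).+1; rewrite oddS; move: (odd _); case: f; case: (e); case.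
by rewrite addbb.
Qed.

Lemma var_cons x d : x != 0 -> var (x :: d) = changes (x < 0) d.
Proof.
rewrite /var /= => /[dup] + ->.
elim: d x => //= y d IH x x0.
have [->|y0] := eqVneq y 0; first exact: IH.
rewrite /= IH //.
have m1 : (-1 == 1 :> R) = false by rewrite eqNr oner_eq0.
case: (ltgtP x 0) x0 => // hx _; case: (ltgtP y 0) y0 => // hy _;
  rewrite ?(ltr0_sg hx) ?(gtr0_sg hx) ?(ltr0_sg hy) ?(gtr0_sg hy) ?eqxx ?m1 //.
by rewrite eq_sym m1.
Qed.

(** The witness is the sign of the first nonzero entry; closing the cycle rounds the linear count up
    to an even number. *)
Lemma cvarE d : ~~ all (fun x => x == 0) d -> exists e,
  cvar d = (changes e d + odd (changes e d))%N /\
  forall f, (changes e d <= changes f d)%N.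
Proof.
rewrite /cvar.
elim: d => // x d IH; have [->|x0] := eqVneq x 0.
  by rewrite /= eqxx; exact: IH.
move=> _; exists (x < 0); rewrite [find _ _]/= x0 drop0 rcons_cons var_cons //.
rewrite changes_rcons //= (negPf x0) eqxx; split=> // f.
by case: f; case: (x < 0).
Qed.

End SignChanges.

(** * Turning directions of plane vectors and bitonic column sequences *)

Section Turning.
Variable R : realDomainType.
Implicit Types (u v w x y : 'cV[R]_2) (s l : seq 'cV[R]_2) (e : bool).

Definition wedge u v : R := u 0 0 * v 1 0 - u 1 0 * v 0 0.

(** [e = false] is a weak counterclockwise turn, [e = true] a weak clockwise one. *)
Definition turn e u v := wsign e (wedge u v).

Definition nonneg u := (0 <= u 0 0) && (0 <= u 1 0).

Definition nonneg_neq0 u := nonneg u && (u != 0).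

Lemma wedgeC u v : wedge v u = - wedge u v.
Proof. by rewrite /wedge; ring. Qed.

Lemma wedgeDl u v w : wedge (u + v) w = wedge u w + wedge v w.
Proof. by rewrite /wedge !mxE; ring. Qed.

Lemma wedgeDr u v w : wedge w (u + v) = wedge w u + wedge w v.
Proof. by rewrite /wedge !mxE; ring. Qed.

Lemma wedgeZl a u w : wedge (a *: u) w = a * wedge u w.
Proof. by rewrite /wedge !mxE; ring. Qed.

Lemma wedgeZr a u w : wedge w (a *: u) = a * wedge w u.
Proof. by rewrite /wedge !mxE; ring. Qed.

Lemma turnNC e u v : turn (~~ e) u v = turn e v u.
Proof.
by rewrite /turn /wsign (wedgeC u v); case: e; rewrite ?oppr_ge0 ?oppr_le0.
Qed.

Lemma turnxx e u : turn e u u.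
Proof. by rewrite /turn /wedge mulrC subrr /wsign lexx; case: e. Qed.

Lemma sum_gt0 u : nonneg_neq0 u -> 0 < u 0 0 + u 1 0.
Proof.
case/andP=> /andP[h0 h1] nz; rewrite lt_def addr_ge0 // andbT.
apply: contraNneq nz => /eqP; rewrite paddr_eq0 // => /andP[/eqP e0 /eqP e1].
apply/eqP/matrixP => i j; rewrite !mxE ord1.
by case: i => -[|[|//]] hi; [rewrite -[RHS]e0|rewrite -[RHS]e1];
  congr (u _ _); apply/val_inj.
Qed.

(* The Pluecker relation between [x], [y], [z] and the functional
   [u |-> u 0 0 + u 1 0]. *)
Lemma turn_trans e x y z : nonneg x -> nonneg_neq0 y -> nonneg z ->
  turn e x y -> turn e y z -> turn e x z.
Proof.
move=> /andP[x0 x1] /sum_gt0 y0 /andP[z0 z1] hxy hyz.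
rewrite /turn -(wsign_pMl _ _ y0).
have -> : (y 0 0 + y 1 0) * wedge x z =
   (z 0 0 + z 1 0) * wedge x y + (x 0 0 + x 1 0) * wedge y z.
  by rewrite /wedge; ring.
by apply: wsignD; apply: wsignMl => //; exact: addr_ge0.
Qed.

Lemma turn_trans_in e : {in nonneg_neq0 & &, transitive (turn e)}.
Proof.
move=> y x z hy /andP[hx _] /andP[hz _]; exact: turn_trans.
Qed.

(** All pairs are compared, not only neighbours: rescaling may create zero columns, and [turn] is
    not transitive through zero. *)
Definition bitonic s := exists e A B C,
  [/\ s = A ++ B ++ C, pairwise (turn e) B & pairwise (turn (~~ e)) (C ++ A)].

Lemma cat_eq_cons (T : Type) (s1 s2 l r : seq T) (u : T) : s1 ++ u :: s2 = l ++ r ->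
  (exists m, l = s1 ++ u :: m /\ s2 = m ++ r) \/
  (exists m, s1 = l ++ m /\ r = m ++ u :: s2).
Proof.
elim: s1 l => [|a s1 IH] [|b l] /=.
- by move=> <-; right; exists [::].
- by case=> -> ->; left; exists l.
- by move=> <-; right; exists (a :: s1).
case=> -> /IH[[m [-> ->]]|[m [-> ->]]]; first by left; exists m.
by right; exists m.
Qed.

Lemma pairwise_multiples e s1 u s2 b :
  (forall y, y \in b -> exists2 a, 0 <= a & y = a *: u) ->
  pairwise (turn e) (s1 ++ u :: s2) -> pairwise (turn e) (s1 ++ b ++ s2).
Proof.
move=> hb; rewrite -cat1s !pairwise_cat !allrel_catr allrel1l allrel1r.
move=> /and3P[/andP[/allP h1 ->] -> /and3P[/allP h2 _ ->]]; rewrite !andbT /=.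
apply/and3P; split.
- apply/allrelP => x y /h1 hx /hb[a a0 ->].
  by rewrite /turn wedgeZr wsignMl.
- apply/allrelP => x y /hb[a a0 ->] /h2 hy.
  by rewrite /turn wedgeZl wsignMl.
elim: b hb => //= y b IH hb; rewrite IH ?andbT; last first.
  by move=> z hz; apply: hb; rewrite inE hz orbT.
have [a a0 ->] := hb y (mem_head _ _).
apply/allP => z hz; have [|c c0 ->] := hb z; first by rewrite inE hz orbT.
by rewrite /turn wedgeZl wedgeZr; do 2 rewrite wsignMl //; exact: turnxx.
Qed.

(** Serves [Double] with [[:: u; u]] and [Rescale] with [[:: a *: u]] as [b]. *)
Lemma bitonic_multiples s1 u s2 b :
  (forall y, y \in b -> exists2 a, 0 <= a & y = a *: u) ->
  bitonic (s1 ++ u :: s2) -> bitonic (s1 ++ b ++ s2).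
Proof.
move=> hb [e [A [B [C [hs hB hCA]]]]]; exists e.
case: (cat_eq_cons hs) hB hCA => [[m [-> ->]] hB|[m [-> hBC]]].
  rewrite catA => /(pairwise_multiples hb).
  by rewrite -catA; exists (s1 ++ b ++ m), B, C; rewrite -!catA.
case: (cat_eq_cons (esym hBC)) => [[m' [-> ->]]|[m' [-> ->]]].
  move=> /(pairwise_multiples hb); exists A, (m ++ b ++ m'), C.
  by split => //; rewrite -!catA.
move=> hB; rewrite -catA cat_cons => /(pairwise_multiples hb).
exists A, B, (m' ++ b ++ s2).
by split => //; rewrite -!catA.
Qed.

Lemma pairwise_add e s1 u v s2 :
  pairwise (turn e) (s1 ++ u :: v :: s2) ->
  pairwise (turn e) (s1 ++ (u + v) :: s2).
Proof.
rewrite !pairwise_cat /= !allrel_consr.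
move=> /and3P[/and3P[h1 h2 ->] -> /and3P[/andP[_ h3] h4 ->]].
rewrite !andbT; apply/andP; split; apply/allP => x hx.
  by rewrite /turn wedgeDr; apply: wsignD; [exact: (allP h1)|exact: (allP h2)].
by rewrite /turn wedgeDl; apply: wsignD; [exact: (allP h3)|exact: (allP h4)].
Qed.

(* Where the turning direction of a bitonic sequence changes, the sum of two
   neighbours can be attached to one of the two adjacent monotone parts. *)
Lemma pairwise_seam e l u v s : all nonneg (l ++ u :: v :: s) ->
  pairwise (turn e) (rcons l u) -> pairwise (turn (~~ e)) (v :: s) ->
  pairwise (turn e) (rcons l (u + v)) /\ pairwise (turn (~~ e)) s \/
  pairwise (turn e) l /\ pairwise (turn (~~ e)) ((u + v) :: s).
Proof.
rewrite all_cat /= => /and4P[/allP hl hu hv /allP hs].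
(* Zero summands are set apart, since [turn_trans] needs a nonzero middle column. *)
have [->|u0] := eqVneq u 0.
  by rewrite add0r !pairwise_rcons => /andP[_ ->]; right.
have [->|v0] := eqVneq v 0.
  by rewrite addr0 /= => -> /andP[_ ->]; left.
have hu' : nonneg_neq0 u by rewrite /nonneg_neq0 hu.
have hv' : nonneg_neq0 v by rewrite /nonneg_neq0 hv.
rewrite /= !pairwise_rcons => /andP[/allP h1 ->] /andP[/allP h2 ->].
rewrite !andbT; case/orP: (wsign_total e (wedge u v)) => huv; [left|right].
all: split=> //; apply/allP => x hx; rewrite /turn ?wedgeDl ?wedgeDr.
  by apply: wsignD; [exact: h1|apply: (turn_trans (y := u)); auto].
by apply: wsignD; [apply: (turn_trans (y := v)); auto|exact: h2].
Qed.

Lemma bitonic_join s1 u v s2 : all nonneg (s1 ++ u :: v :: s2) ->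
  bitonic (s1 ++ u :: v :: s2) -> bitonic (s1 ++ (u + v) :: s2).
Proof.
move=> hnn [e [A [B [C [hs hB hCA]]]]].
(* At the seam between [A] and [B], the monotone part on the left is read cyclically, as
   [C' ++ rcons A' u]. *)
have seamAB A' B' C' : A' ++ u :: v :: B' ++ C' = s1 ++ u :: v :: s2 ->
    pairwise (turn e) (v :: B') -> pairwise (turn (~~ e)) (C' ++ rcons A' u) ->
    bitonic (A' ++ (u + v) :: B' ++ C').
  move=> hs'; rewrite -hs' in hnn.
  rewrite -{1}[e]negbK -rcons_cat => h1 h2.
  have hnn' : all nonneg ((C' ++ A') ++ u :: v :: B').
    move: hnn; rewrite !all_cat /= all_cat.
    by move=> /and5P[-> -> -> -> ->].
  case: (pairwise_seam hnn' h2 h1); rewrite negbK => -[h3 h4]; exists e.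
    exists (rcons A' (u + v)), B', C'; split => //; first by rewrite cat_rcons.
    by rewrite -rcons_cat.
  by exists A', (u + v :: B'), C'.
case: (cat_eq_cons hs) hB hCA => [[[|v' m] [hA hs2]]|[m [hs1 hBC]]].
- clear hs; rewrite /= in hs2; rewrite hA; case: B hs2 => [|v' B] /= hs2 hB hCA.
    (* With [B] empty, [v] leaves [C] and becomes the middle part, a single column being monotone in
       either direction. *)
    case: C hs2 hCA => // v' C [<- hs2]; rewrite -hs2 => hCA.
    rewrite -[s2]cat0s; apply: (seamAB _ [::]) => //.
    by move: hCA; rewrite /= cats1 => /andP[].
  case: hs2 hB => <- hs2 hB; rewrite cats1 in hCA; rewrite hs2.
  by apply: seamAB; rewrite ?hs2.
- case: hs2 hA => <- -> -> hB; rewrite catA => /pairwise_add; rewrite -catA.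
  by exists e, (s1 ++ (u + v) :: m), B, C; rewrite -catA.
move=> hB hCA; rewrite hs1.
case: (cat_eq_cons (esym hBC)) hB hCA => [[[|v' m'] [hB' hs2]]|[m' [-> ->]]].
- rewrite /= in hs2; rewrite -hs2 hB' cats1 => hB hCA.
  have hnn' : all nonneg (m ++ u :: v :: (s2 ++ A)).
    move: hnn; rewrite hs1 !all_cat /= all_cat.
    by move=> /and4P[/andP[-> ->] -> -> ->].
  rewrite /= in hCA.
  case: (pairwise_seam hnn' hB hCA) => -[h3 h4]; exists e.
    by exists A, (rcons m (u + v)), s2; split => //; rewrite cat_rcons catA.
  by exists A, m, (u + v :: s2); split => //; rewrite catA.
- case: hs2 hB' => <- -> -> /pairwise_add hB hCA.
  by exists e, A, (m ++ (u + v) :: m'), C; split; rewrite -?catA // catA.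
move=> hB; rewrite -catA => /pairwise_add hCA.
by exists e, A, B, (m' ++ (u + v) :: s2); split; rewrite -?catA // catA.
Qed.

(** If [C] is nonempty, its last column moves to the front of [A], leaving [C ++ A] unchanged. If
    only [C] is empty, the two directions exchange roles and [A] becomes the middle part. *)
Lemma bitonic_shift s u : bitonic (rcons s u) -> bitonic (u :: s).
Proof.
move=> [e [A [B [C [hs hB hCA]]]]].
case/lastP: C hs hCA => [|C x].
  rewrite cats0 /= => hs hA; case/lastP: B hs hB => [|B x].
    rewrite cats0 => hs _; exists e, [:: u], [::], s; split => //.
    by rewrite cats1 hs.
  rewrite -rcons_cat => /rcons_inj[-> <-] hB.
  by exists (~~ e), [:: u], A, B; rewrite negbK cats1.
rewrite -!rcons_cat => /rcons_inj[-> <-] h.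
by exists e, (u :: A), B, C; split => //; rewrite -cat_rcons.
Qed.

Lemma column_op_bitonic s s' : column_op s s' ->
  all nonneg s /\ bitonic s -> all nonneg s' /\ bitonic s'.
Proof.
case=> [s1 u v s2|s1 u s2|s0 u|s1 u s2 a a0] [hnn hs].
- split; last exact: bitonic_join.
  move: hnn; rewrite !all_cat /= /nonneg !mxE.
  by move=> /and4P[-> /andP[? ?] /andP[? ?] ->]; rewrite !addr_ge0.
- split.
    by move: hnn; rewrite !all_cat /= => /and3P[-> -> ->].
  apply: (bitonic_multiples (b := [:: u; u])) hs.
  by move=> y; rewrite !inE orbb => /eqP->; exists 1; rewrite ?scale1r.
- split; last exact: bitonic_shift.
  by rewrite all_rcons in hnn.
split.
  move: hnn; rewrite !all_cat /= /nonneg !mxE.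
  by move=> /and3P[-> /andP[? ?] ->]; rewrite !mulr_ge0.
apply: (bitonic_multiples (b := [:: a *: u])) hs.
by move=> y; rewrite !inE => /eqP->; exists a.
Qed.

(** * Bitonic sequences versus sign changes of consecutive determinants *)

Definition cyclic_wedges s : seq R :=
  if s is x :: s' then pairmap wedge x (rcons s' x) else [::].

Lemma all_wsign_pairmap e x s :
  all (wsign e) (pairmap wedge x s) = path (turn e) x s.
Proof. by elim: s x => //= y s IH x; rewrite IH. Qed.

(** Only the first wedge, across the seam from [x] into [s], has unknown sign; [changes_cons]
    absorbs it. *)
Lemma changes_pairmap e x s d : sorted (turn (~~ e)) s ->
  (changes e (pairmap wedge x s ++ d) <= (changes (~~ e) d).+1)%N.
Proof.
case: s => [_|y s hs]; first exact: changes_flip.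
rewrite [pairmap _ _ _]/= cat_cons (leq_trans (changes_cons _ _ _)) //.
by rewrite changes_cat_wsign // all_wsign_pairmap.
Qed.

Lemma bitonic_changes s : bitonic s ->
  exists e, (changes e (cyclic_wedges s) <= 2)%N.
Proof.
have main e x A B C : pairwise (turn e) B ->
    pairwise (turn (~~ e)) (C ++ x :: A) ->
    exists e, (changes e (cyclic_wedges ((x :: A) ++ B ++ C)) <= 2)%N.
  move=> /pairwise_sorted hB /pairwise_sorted; rewrite -cat_rcons => h.
  have hA : path (turn (~~ e)) x A.
    by move: h; rewrite cat_rcons => /cat_sorted2[].
  have /cat_sorted2[hC _] := h.
  exists (~~ e); rewrite /= !rcons_cat !pairmap_cat.
  rewrite changes_cat_wsign ?all_wsign_pairmap //.
  rewrite (leq_trans (changes_pairmap _ _ _)) ?negbK // ltnS.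
  rewrite -[pairmap _ _ (rcons _ _)]cats0.
  exact: changes_pairmap.
move=> [e [A [B [C [-> hB hCA]]]]].
(* [main] starts the cycle in a nonempty first part; with [A] empty, the first nonempty one of [B]
   and [C] takes its place. *)
case: A hCA => [|x A]; last exact: main.
rewrite cats0 => hC; case: B hB => [|x B] hB.
  case: C hC => [_|x C hC]; first by exists true.
  by rewrite -[_ ++ _](cats0 (x :: C)); apply: (main e x C [::] [::]).
by rewrite -(cats0 C); apply: (main (~~ e)); rewrite ?negbK.
Qed.

Lemma sorted_belast (T : Type) (r : rel T) (x : T) (s : seq T) :
  path r x s -> sorted r (belast x s).
Proof.
rewrite -[path r x s]/(sorted r (x :: s)) lastI -cats1.
by move=> /cat_sorted2[].
Qed.

(** Two changes cut the wedges into runs of signs [e], [~~ e], [e]; as the columns are nonzero,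
    transitivity extends each run from neighbours to all pairs. *)
Lemma changes_bitonic e s : all nonneg_neq0 s ->
  (changes e (cyclic_wedges s) <= 2)%N -> bitonic s.
Proof.
case: s => [_ _|x s hs]; first by exists true, [::], [::], [::].
move=> /changes_split[d1 [d' [hd h1 /changes_split[d2 [d3 [hd' h2 h3]]]]]].
have {}h3 : all (wsign e) d3.
  by apply: changes0; apply/eqP; rewrite -leqn0 -[e]negbK.
have cut (z : 'cV[R]_2) t c1 c2 : pairmap wedge z t = c1 ++ c2 ->
    exists t1 t2, [/\ t = t1 ++ t2, c1 = pairmap wedge z t1
                    & c2 = pairmap wedge (last z t1) t2].
  elim: c1 z t => [|a c1 IH] z t /=; first by exists [::], t.
  case: t => //= y t [<- /IH[t1 [t2 [-> -> ->]]]].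
  by exists (y :: t1), t2.
rewrite hd' in hd.
case/cut: hd => t1 [t' [ht ed1 /esym/cut[t2 [t3 [ht' ed2 ed3]]]]].
rewrite ed1 all_wsign_pairmap in h1; rewrite ed2 all_wsign_pairmap in h2.
rewrite ed3 all_wsign_pairmap in h3.
(* Successive runs share the column at the cut; [belast] leaves it to the later run, and drops the
   closing copy of [x]. *)
have es : x :: s = belast x t1 ++ belast (last x t1) t2
                   ++ belast (last (last x t1) t2) t3.
  by rewrite -!belast_cat -ht' -ht belast_rcons.
move: (hs); rewrite es !all_cat => /and3P[hA hB hC].
exists (~~ e), (belast x t1), (belast (last x t1) t2),
  (belast (last (last x t1) t2) t3); rewrite negbK; split => //.
  rewrite -(sorted_pairwise_in (turn_trans_in (e := ~~ e))) //.
  exact: sorted_belast.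
rewrite -(sorted_pairwise_in (turn_trans_in (e := e))) ?all_cat ?hC //.
have [->|t3n] := eqVneq t3 [::]; first exact: sorted_belast.
(* The third run ends at [x], where the first begins, so the two form one path. *)
have lt3 : last (last (last x t1) t2) t3 = x.
  by rewrite -!last_cat -ht' -ht last_rcons.
rewrite -{2}lt3 -belast_cat; apply: sorted_belast.
by rewrite cat_path h3 lt3.
Qed.

(** Along the closed walk from [x] back to [x], transitivity makes [x] turn to [y] and [y] to [x] in
    the same direction. *)
Lemma cyclic_wedges_monotone e x s : all nonneg_neq0 (x :: s) ->
  all (wsign e) (cyclic_wedges (x :: s)) ->
  {in x :: s, forall y, wedge x y = 0}.
Proof.
move=> hs; rewrite all_wsign_pairmap.
rewrite (path_pairwise_in (turn_trans_in (e := e))); last first.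
  by move: hs; rewrite /= all_rcons => /andP[-> ->].
rewrite -rcons_cons pairwise_rcons => /andP[/allP h1 /andP[/allP h2 _]] y hy.
apply: (wsign_both (e := e)).
  move: hy; rewrite inE => /predU1P[->|/h2 //]; exact: turnxx.
by have := h1 y hy; rewrite -turnNC.
Qed.

End Turning.

Arguments nonneg {R} u.
Arguments nonneg_neq0 {R} u.
Arguments turn {R} e u v.

(** * Constructing bitonic sequences from the two axes *)

Section Construct.
Variable R : realFieldType.
Implicit Types (u v w : 'cV[R]_2) (s : seq 'cV[R]_2).

Definition reach : seq 'cV[R]_2 -> seq 'cV[R]_2 -> Prop :=
  clos_refl_trans _ (@column_op R).

Lemma reach_refl s : reach s s.
Proof. exact: rt_refl. Qed.

Lemma reach_step s s' : column_op s s' -> reach s s'.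
Proof. exact: rt_step. Qed.

Lemma reach_trans s1 s2 s3 : reach s1 s2 -> reach s2 s3 -> reach s1 s3.
Proof. exact: rt_trans. Qed.

(** Indexed so that the quadrant is swept in direction [e] from [axis e] to [axis (~~ e)]. *)
Definition axis (e : bool) : 'cV[R]_2 := col (if e then 1 else 0) 1%:M.

Lemma axisE e i : axis e i 0 = (i == (if e then 1 else 0))%:R.
Proof. by rewrite !mxE. Qed.

Lemma cV2P u v : u 0 0 = v 0 0 -> u 1 0 = v 1 0 -> u = v.
Proof.
move=> h0 h1; apply/matrixP => i j; rewrite ord1.
by case: i => -[|[|//]] hi; [move: h0|move: h1]; congr (u _ _ = v _ _);
  apply/val_inj.
Qed.

Lemma reach_insert s1 u v s2 (a b : R) : 0 <= a -> 0 <= b ->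
  reach (s1 ++ u :: v :: s2) (s1 ++ u :: (a *: u + b *: v) :: v :: s2).
Proof.
move=> a0 b0.
apply: reach_trans (reach_step (Double s1 u (v :: s2))) _.
rewrite -!(cat_rcons u s1).
apply: reach_trans (reach_step (Rescale (rcons s1 u) u (v :: s2) a0)) _.
rewrite -(cat_rcons (a *: u)).
apply: reach_trans (reach_step (Double _ v s2)) _.
apply: reach_trans (reach_step (Rescale _ v (v :: s2) b0)) _.
by rewrite (cat_rcons (a *: u)); exact: reach_step (Join _ _ _ _).
Qed.

Lemma reach_delete s1 u s2 : s1 ++ s2 != [::] ->
  reach (s1 ++ u :: s2) (s1 ++ s2).
Proof.
move=> hn.
apply: reach_trans (reach_step (Rescale s1 u s2 (lexx 0))) _; rewrite scale0r.
case: s2 hn => [|v s2] hn.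
  case/lastP: s1 hn => // s1 v _; rewrite cats0 cat_rcons -cats1.
  have := Join s1 v 0 [::]; rewrite addr0; exact: reach_step.
by have := Join s1 0 v s2; rewrite add0r; exact: reach_step.
Qed.

Lemma reach_rot s1 s2 : reach (s1 ++ s2) (s2 ++ s1).
Proof.
elim/last_ind: s2 s1 => [|s2 u IH] s1; first by rewrite cats0; exact: reach_refl.
rewrite -rcons_cat cat_rcons.
exact: reach_trans (reach_step (CyclicShift _ u)) (IH (u :: s1)).
Qed.

Lemma turn_cone e w v : nonneg w -> nonneg_neq0 v -> turn e w v ->
  exists a b, [/\ 0 <= a, 0 <= b & w = a *: axis e + b *: v].
Proof.
move=> /andP[w0 w1] /[dup] /sum_gt0 vs /andP[/andP[v0 v1] _].
case: e; rewrite /turn /wedge /= => h.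
- have [v00|v00] := eqVneq (v 0 0) 0.
    exists (w 1 0), 0; split => //; apply: cV2P; rewrite !mxE /=; last by ring.
    by rewrite v00 in h vs; nra.
  have v0p : 0 < v 0 0 by rewrite lt_def v00.
  (* The second coefficient matches the coordinate where [axis e] vanishes; the first is
     [- wedge w v / v 0 0], nonnegative by [h]. *)
  exists (w 1 0 - w 0 0 * v 1 0 / v 0 0), (w 0 0 / v 0 0); split.
  + by rewrite subr_ge0 ler_pdivrMr // -subr_le0.
  + by rewrite divr_ge0.
  by apply: cV2P; rewrite !mxE /=; field.
have [v10|v10] := eqVneq (v 1 0) 0.
  exists (w 0 0), 0; split => //; apply: cV2P; rewrite !mxE /=; first by ring.
  by rewrite v10 in h vs; nra.
have v1p : 0 < v 1 0 by rewrite lt_def v10.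
exists (w 0 0 - w 1 0 * v 0 0 / v 1 0), (w 1 0 / v 1 0); split.
+ by rewrite subr_ge0 ler_pdivrMr // -subr_ge0.
+ by rewrite divr_ge0.
by apply: cV2P; rewrite !mxE /=; field.
Qed.

Lemma nonneg_axis e : nonneg_neq0 (axis e).
Proof.
rewrite /nonneg_neq0 /nonneg !axisE !ler0n /=; apply/eqP => h.
have := axisE e (if e then 1 else 0); rewrite h eqxx mxE => /eqP.
by rewrite eq_sym oner_eq0.
Qed.

Lemma turn_axis e w : nonneg w -> turn e w (axis (~~ e)).
Proof.
move=> /andP[w0 w1]; rewrite /turn /wedge !axisE.
by case: e; rewrite /= ?mulr0 ?mulr1 ?subr0 ?add0r ?oppr_le0.
Qed.

Lemma reach_fan e s1 B s2 : all nonneg_neq0 B -> pairwise (turn e) B ->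
  reach (s1 ++ axis e :: axis (~~ e) :: s2)
        (s1 ++ axis e :: B ++ axis (~~ e) :: s2).
Proof.
elim: B => [|w B IH] /=; first by move=> *; exact: reach_refl.
move=> /andP[/andP[hw _] hB] /andP[hwB pB].
apply: reach_trans (IH hB pB) _.
(* [B] is inserted from its last column to its first, so [w] goes between [axis e] and the head [h]
   of what already follows. *)
have [h [t [-> hh hwh]]] : exists h t,
    [/\ B ++ axis (~~ e) :: s2 = h :: t, nonneg_neq0 h & turn e w h].
  case: B hB hwB {IH pB} => [_ _|y B /andP[hy _] /andP[hwy _]].
    exists (axis (~~ e)), s2; split=> //; first exact: nonneg_axis.
    exact: turn_axis.
  by exists y, (B ++ axis (~~ e) :: s2).
have [a [b [a0 b0 {1}->]]] := turn_cone hw hh hwh.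
exact: reach_insert.
Qed.

Lemma bitonic_reach s : s != [::] -> all nonneg_neq0 s -> bitonic s ->
  reach [:: axis false; axis true] s.
Proof.
have main B D : B ++ D != [::] -> all nonneg_neq0 B -> all nonneg_neq0 D ->
    pairwise (turn false) B -> pairwise (turn true) D ->
    reach [:: axis false; axis true] (B ++ D).
  move=> hn nB nD pB pD.
  apply: reach_trans (reach_rot [:: axis false] [:: axis true]) _.
  apply: reach_trans (reach_fan [::] [::] nD pD) _.
  apply: reach_trans (reach_rot (axis true :: D) [:: axis false]) _.
  apply: reach_trans (reach_fan [::] D nB pB) _.
  apply: reach_trans (@reach_delete [::] _ _ _) _; first by case: (B).
  exact: reach_delete.
move=> hn hs [e [A [B [C [es hB hCA]]]]]; subst s.
move: hs; rewrite !all_cat => /and3P[nA nB nC].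
have nCA : all nonneg_neq0 (C ++ A) by rewrite all_cat nC.
(* [main] puts the counterclockwise part first; a rotation then restores the order [A], [B], [C]. *)
case: e hB hCA => hB hCA.
  have hn' : (C ++ A) ++ B != [::].
    by case: A B C hn {nA nB nC nCA hB hCA} => [|? ?] [|? ?] [|? ?].
  apply: reach_trans (main _ _ hn' nCA nB hCA hB) _.
  rewrite -catA; apply: reach_trans (reach_rot _ _) _.
  by rewrite -catA; exact: reach_refl.
have hn' : B ++ (C ++ A) != [::].
  by case: A B C hn {nA nB nC nCA hB hCA} => [|? ?] [|? ?] [|? ?].
apply: reach_trans (main _ _ hn' nB nCA hB hCA) _.
by rewrite (catA B C A); exact: reach_rot.
Qed.

Lemma bitonic_axes : bitonic [:: axis false; axis true].
Proof.
exists false, [::], [:: axis false; axis true], [::]; split=> //=.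
rewrite !andbT; apply: (turn_axis false).
by case/andP: (nonneg_axis false).
Qed.

Lemma reach_bitonic s : reach [:: axis false; axis true] s -> bitonic s.
Proof.
have: all nonneg [:: axis false; axis true]
      /\ bitonic [:: axis false; axis true].
  split; last exact: bitonic_axes.
  by rewrite /=; case/andP: (nonneg_axis false) => -> _;
     case/andP: (nonneg_axis true) => -> _.
move=> h hs; suff [] : all nonneg s /\ bitonic s by [].
elim: hs h => // [x y|x y z _ IH1 _ IH2 /IH1/IH2 //].
exact: column_op_bitonic.
Qed.

(** * From matrices to column sequences *)

Lemma columns1 : columns (1%:M : 'M[R]_2) = [:: axis false; axis true].
Proof.
rewrite /columns enum_ordSl enum_ordSl enum_ord0 /=.
by congr [:: _; _]; congr (col _ _); apply/val_inj.
Qed.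

Lemma Delta_wedge n (M : 'M[R]_(2, n)) i :
  Delta M i = wedge (col i M) (col (ordS i) M).
Proof.
rewrite /Delta (expand_det_row _ 0) big_ord_recl big_ord1 /cofactor.
have s0 : split (0 : 'I_(1 + 1)) = inl 0.
  by case: splitP => [j _|j] //=; rewrite ord1.
have s1 : split (1 : 'I_(1 + 1)) = inr 0.
  by case: splitP => [[[|//] ?]|j _] //=; rewrite ord1.
have l0 : lift 0 0 = 1 :> 'I_2 by apply/val_inj.
have l1 : lift 1 0 = 0 :> 'I_2 by apply/val_inj.
rewrite !det_mx11 !mxE l0 l1 s0 s1 /wedge !mxE /= expr0 expr1.
by ring.
Qed.

Lemma Delta_cyclic_wedges n (M : 'M[R]_(2, n)) :
  [seq Delta M i | i <- enum 'I_n] = cyclic_wedges (columns M).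
Proof.
case: n M => [|n] M; first by rewrite /columns !enum_ord0.
have sz : size (columns M) = n.+1 by rewrite size_map size_enum_ord.
have nthc i (hi : (i < n.+1)%N) : nth 0 (columns M) i = col (Ordinal hi) M.
  rewrite (nth_map (Ordinal hi)) ?size_enum_ord //; congr (col _ _).
  by apply/val_inj; rewrite /= nth_enum_ord.
case es : (columns M) sz => [//|x s] [sz].
apply: (@eq_from_nth _ 0) => [|i].
  by rewrite size_pairmap size_rcons size_map size_enum_ord sz.
rewrite size_map size_enum_ord => hi.
rewrite (nth_map (Ordinal hi)) ?size_enum_ord // (nth_pairmap 0) ?size_rcons ?sz //.
have -> : nth (Ordinal hi) (enum 'I_n.+1) i = Ordinal hi.
  by apply/val_inj; rewrite /= nth_enum_ord.
rewrite Delta_wedge -rcons_cons nth_rcons /= sz ltnS -ltnS hi -es nthc.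
congr wedge; rewrite nth_rcons sz.
have [lt_in|ge_in] := ltnP i n.
  have -> : nth 0 s i = nth 0 (columns M) i.+1 by rewrite es.
  rewrite (nthc _ (lt_in : i.+1 < n.+1)%N); congr (col _ _).
  by apply/val_inj; rewrite /= modn_small.
(* At the last index [ordS] wraps to 0, matching the copy of [x] appended by [cyclic_wedges]. *)
have ein : i = n by apply/eqP; rewrite eqn_leq ge_in andbT -ltnS.
rewrite {1}[in RHS]ein eqxx -[x]/(nth 0 (x :: s) 0) -es (nthc _ (ltn0Sn n)).
by congr (col _ _); apply/val_inj; rewrite /= ein modnn.
Qed.

(** The row [k] sends each column [v] to [wedge u v], so it annihilates [M]; rank 2 would force [k],
    hence [u], to vanish. *)
Lemma rank_lt2 n (M : 'M[R]_(2, n)) u : u != 0 ->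
  {in columns M, forall v, wedge u v = 0} -> \rank M != 2%N.
Proof.
move=> u0 hM; apply: contraNneq u0 => hr.
have fM : row_free M by rewrite /row_free hr.
pose k : 'rV[R]_2 := \row_i (if i == 0 then - u 1 0 else u 0 0).
have kM : k *m M = 0.
  apply/rowP => j; rewrite !mxE big_ord_recl big_ord1 !mxE /=.
  have /hM : col j M \in columns M by apply: map_f; rewrite mem_enum.
  rewrite /wedge !mxE => <-.
  have -> : lift ord0 ord0 = 1 :> 'I_2 by apply/val_inj.
  by ring.
have /eqP/rowP k0 : k == 0 by rewrite -(mulmx_free_eq0 _ fM) kM.
apply/eqP/cV2P; rewrite [RHS]mxE.
  by have := k0 1; rewrite !mxE.
by have := k0 0; rewrite !mxE /= => /eqP; rewrite oppr_eq0 => /eqP.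
Qed.

(** The minimal linear count [k] is positive, as a single sign would make all columns parallel;
    hence rounding [k] up to even gives 2 exactly when [k] is 1 or 2. *)
Lemma cvar_mxE2 n (M : 'M[R]_(2, n)) :
  columns M != [::] -> all nonneg_neq0 (columns M) -> \rank M = 2%N ->
  cvar_mx M = 2%N <-> exists e, (changes e (cyclic_wedges (columns M)) <= 2)%N.
Proof.
move=> hn hnn hr; rewrite /cvar_mx Delta_cyclic_wedges.
case es : (columns M) hn hnn => [//|x s] _ hnn.
have nomono e : ~~ all (wsign e) (cyclic_wedges (x :: s)).
  apply/negP => h; have := @rank_lt2 _ M x.
  rewrite es hr eqxx => /(_ _ (cyclic_wedges_monotone hnn h)).
  by case/andP: hnn => /andP[_ ->] _ /(_ isT).
have /cvarE[e [-> emin]] : ~~ all (fun z => z == 0) (cyclic_wedges (x :: s)).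
  apply: contra (nomono false); apply: sub_all => y /eqP->.
  exact: lexx.
have := nomono e; set k := changes _ _ in emin *.
have [k0|] := posnP k; first by rewrite changes0.
move=> kp _; split=> [h|[f /(leq_trans (emin f))]].
  by exists e; rewrite -/k; lia.
by case: k kp {emin} => [|[|[|]]].
Qed.

End Construct.

Theorem theorem4p9 (R : realType) (n : nat) (M : 'M[R]_(2, n))
    (M_ge0 : forall i j, 0 <= M i j)
    (M_rank : \rank M = 2%N)
    (M_col_neq0 : forall j, col j M != 0) :
  cvar_mx M = 2%N <-> constructible_from (1%:M : 'M[R]_2) M.
Proof.
have hnn : all nonneg_neq0 (columns M).
  apply/allP => _ /mapP[j _ ->].
  by rewrite /nonneg_neq0 M_col_neq0 /nonneg !mxE !M_ge0.
have hn : columns M != [::].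
  rewrite -size_eq0 size_map size_enum_ord -lt0n.
  by apply: leq_trans (rank_leq_col M); rewrite M_rank.
rewrite cvar_mxE2 // /constructible_from columns1; split.
  by move=> [e h]; apply: bitonic_reach => //; exact: changes_bitonic h.
by move/reach_bitonic/bitonic_changes.
Qed.
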